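(* Let $k_1=k_2=k_3,\lambda_1,\lambda_2,f$ be positive constants, $0<\theta_0<\pi/2$, and let $q=\frac{2\pi n_0}{h}$ for a fixed positive integer $n_0$. Then: (i) if $d+2\lambda_2q^4\cos^4\theta_0>0$ (high temperature, where $d=\alpha_2(T-T_2^* )$), the cholesteric helical configuration $(\theta\equiv0,\delta\rho\equiv0)$ is a stable critical point of the energy $F(\theta,\delta\rho)$ defined in the context; (ii) the cholesteric helical configuration loses its stability as the temperature decreases: if $d+2\lambda_2q^4\cos^4\theta_0<0$, the critical point $(\theta\equiv0,\delta\rho\equiv0)$ is unstable.
   Context: Let $h>0$, $\sigma=2\pi/p>0$ ($p>0$ the pitch), $\alpha_2>0$, and $d=\alpha_2(T-T_2^* )\in\mathbb R$ with temperature $T$. When $k_1=k_2=k_3$ the energy is $$F(\theta,\delta\rho)=\int_0^h\Big\{k_1\theta_z^2-k_1\sigma^2\cos^2\theta+\tfrac d2\delta\rho^2+\tfrac f4\delta\rho^4+\lambda_1(\delta\rho_{zz}+q^2\delta\rho)^2+\lambda_2\big(\sin^2\theta\,\delta\rho_{zz}+q^2\delta\rho\cos^2\theta_0\big)^2\Big\}\,dz .$$ Admissible functions: $\theta\in W^{1,2}(0,h)$ with values in $[-\pi/2,\pi/2]$ and natural (Neumann) conditions $\theta_z(0)=\theta_z(h)=0$; $\delta\rho\in W_{\delta\rho}$, the $W^{2,2}(0,h)$ functions with periodic conditions $\delta\rho(0)=\delta\rho(h)$, $\delta\rho_z(0)=\delta\rho_z(h)$ (and $\delta\rho_{zz}(0)=\delta\rho_{zz}(h)$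 as a natural boundary condition). The second variation at $(0,0)$ is $\delta^2F(\eta_1,\eta_2)=\frac{d^2}{d\varepsilon^2}\big|_{\varepsilon=0}F(\varepsilon\eta_1,\varepsilon\eta_2)$, and $$\mu_T=\inf_{\eta_1\in W^{1,2}(0,h),\ \eta_2\in W_{\delta\rho},\ (\eta_1,\eta_2)\ne(0,0)}\frac{\delta^2F(\eta_1,\eta_2)}{\int_0^h(\eta_1^2+\eta_2^2)\,dz}.$$ The critical point $(0,0)$ is called stable if $\mu_T>0$ and unstable if $\mu_T<0$. *)

(* Defs.v *)
From mathcomp Require Import all_boot all_order all_algebra.
From mathcomp Require Import all_classical all_reals all_analysis.

Set Implicit Arguments.
Unset Strict Implicit.
Unset Printing Implicit Defensive.

Import Order.TTheory GRing.Theory Num.Theory.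
Import numFieldNormedType.Exports.

Local Open Scope classical_set_scope.
Local Open Scope ring_scope.

(* Only the values on ]0, h[ matter. *)
Definition L2 (R : realType) (h : R) (u : R -> R) : Prop :=
  measurable_fun `]0, h[ u /\
  (@lebesgue_measure R).-integrable `]0, h[ (fun x => (u x ^+ 2)%:E).

Definition test_function (R : realType) (h : R) (phi : R -> R) : Prop :=
  (forall (n : nat) (x : R), derivable (phi^`(n))%classic x 1) /\
  compact (closure [set x | phi x != 0]) /\
  closure [set x | phi x != 0] `<=` `]0, h[.

Definition weak_derivative (R : realType) (h : R) (u v : R -> R) : Prop :=
  forall phi : R -> R, test_function h phi ->
    \int[@lebesgue_measure R]_(x in `]0, h[) (u x * phi^`()%classic x) =
    - \int[@lebesgue_measure R]_(x in `]0, h[) (v x * phi x).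

(* A Sobolev function is carried together with its weak derivatives, so that a
   functional may refer to them; the pairs and triples inherit pointwise
   addition and scaling. A weak derivative is unique up to a null set, and no
   integral below depends on its choice. *)
Definition sob1 (R : realType) : Type := ((R -> R) * (R -> R))%type.
Definition sob2 (R : realType) : Type := ((R -> R) * (R -> R) * (R -> R))%type.

Definition fn1 (R : realType) (u : sob1 R) : R -> R := u.1.
Definition dz1 (R : realType) (u : sob1 R) : R -> R := u.2.
Definition fn2 (R : realType) (u : sob2 R) : R -> R := u.1.1.
Definition dz2 (R : realType) (u : sob2 R) : R -> R := u.1.2.
Definition dzz2 (R : realType) (u : sob2 R) : R -> R := u.2.

(* W^{1,2}(0,h). Each class is represented by its unique continuous
   representative on [0, h], which gives a meaning to the boundary values. *)
Definition W12 (R : realType) (h : R) (u : sob1 R) : Prop :=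
  [/\ {within `[0, h], continuous (fn1 u)},
      L2 h (fn1 u), L2 h (dz1 u) & weak_derivative h (fn1 u) (dz1 u)].

Definition W22 (R : realType) (h : R) (u : sob2 R) : Prop :=
  W12 h (fn2 u, dz2 u) /\ W12 h (dz2 u, dzz2 u).

Definition W22per (R : realType) (h : R) (u : sob2 R) : Prop :=
  [/\ W22 h u, fn2 u 0 = fn2 u h & dz2 u 0 = dz2 u h].

Definition right_derivative (R : realType) (u : R -> R) (a l : R) : Prop :=
  (u x - u a) / (x - a) @[x --> a^'+] --> l.

Definition left_derivative (R : realType) (u : R -> R) (a l : R) : Prop :=
  (u x - u a) / (x - a) @[x --> a^'-] --> l.

(* The natural boundary conditions are imposed on configurations, pointwise
   through one-sided derivatives (the weak derivatives of highest order have no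
   trace); they are not part of the spaces in which the variations range. *)
Definition admissible (R : realType) (h : R) (theta : sob1 R) (rho : sob2 R)
    : Prop :=
  [/\ W12 h theta,
      (forall x, 0 <= x <= h -> - (pi / 2) <= fn1 theta x <= pi / 2),
      right_derivative (fn1 theta) 0 0 /\ left_derivative (fn1 theta) h 0,
      W22per h rho
    & exists l, right_derivative (dz2 rho) 0 l /\ left_derivative (dz2 rho) h l].

Definition energy (R : realType)
    (h k1 sigma d f lambda1 lambda2 q theta0 : R)
    (theta : sob1 R) (rho : sob2 R) : R :=
  \int[@lebesgue_measure R]_(z in `]0, h[)
    (k1 * dz1 theta z ^+ 2 - k1 * sigma ^+ 2 * cos (fn1 theta z) ^+ 2
     + d / 2 * fn2 rho z ^+ 2 + f / 4 * fn2 rho z ^+ 4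
     + lambda1 * (dzz2 rho z + q ^+ 2 * fn2 rho z) ^+ 2
     + lambda2 * (sin (fn1 theta z) ^+ 2 * dzz2 rho z
                  + q ^+ 2 * fn2 rho z * cos theta0 ^+ 2) ^+ 2).

Definition critical_point (R : realType) (h : R) (F : sob1 R -> sob2 R -> R)
    (theta : sob1 R) (rho : sob2 R) : Prop :=
  admissible h theta rho /\
  forall (eta1 : sob1 R) (eta2 : sob2 R), W12 h eta1 -> W22per h eta2 ->
    is_derive (0 : R) (1 : R)
      (fun e : R => F (theta + e *: eta1) (rho + e *: eta2)) 0.

Definition second_variation (R : realType) (F : sob1 R -> sob2 R -> R)
    (eta1 : sob1 R) (eta2 : sob2 R) : R :=
  (fun e : R => F (e *: eta1) (e *: eta2))^`(2)%classic 0.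

Definition mu_T (R : realType) (h : R) (F : sob1 R -> sob2 R -> R) : \bar R :=
  ereal_inf [set r | exists (eta1 : sob1 R) (eta2 : sob2 R),
    [/\ W12 h eta1, W22per h eta2,
        ~ (forall x, 0 <= x <= h -> fn1 eta1 x = 0 /\ fn2 eta2 x = 0)
      & r = (second_variation F eta1 eta2 /
             \int[@lebesgue_measure R]_(z in `]0, h[)
               (fn1 eta1 z ^+ 2 + fn2 eta2 z ^+ 2))%:E]].

Definition stable_at_zero (R : realType) (h : R) (F : sob1 R -> sob2 R -> R)
    : Prop := (0 < mu_T h F)%E.

Definition unstable_at_zero (R : realType) (h : R) (F : sob1 R -> sob2 R -> R)
    : Prop := (mu_T h F < 0)%E.

(* Main.v *)
(* Expanding cos^2 = 1 - sin^2, the energy along (e eta1, e eta2) is a polynomial in e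
   plus integrals of w(z) sin^n(e eta1(z)) with w integrable and eta1 bounded, which may be
   differentiated under the integral sign. This yields
     second variation = int 2 k1 (eta1'^2 + sigma^2 eta1^2)
       + (d + 2 lambda2 q^4 cos^4 theta0) eta2^2 + 2 lambda1 (eta2'' + q^2 eta2)^2,
   so mu_T >= min (2 k1 sigma^2) (d + 2 lambda2 q^4 cos^4 theta0), while the pair
   (0, sin (q z)) annihilates eta2'' + q^2 eta2 and attains the second of these values. *)

Require Import Defs.
From mathcomp Require Import all_boot all_order all_algebra.
From mathcomp Require Import all_classical all_reals all_analysis measurable_realfun.
From mathcomp Require Import ring lra.
Set Implicit Arguments.
Unset Strict Implicit.
Unset Printing Implicit Defensive.
Import Order.TTheory GRing.Theory Num.Theory.
Import numFieldNormedType.Exports.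
Local Open Scope classical_set_scope.
Local Open Scope ring_scope.

(** * Differentiation under the integral sign for integrals of [w y * phi (e * u y)] *)

Section DilationIntegral.
Context {R : realType} {d : measure_display} {Y : measurableType d}.
Context (mu : {measure set Y -> \bar R}) (B : set Y) (mB : measurable B).
Implicit Types (w u g : Y -> R) (phi psi : R -> R).

Lemma integrable_mul_bounded w g (M : R) :
  mu.-integrable B (EFin \o w) -> measurable_fun B g ->
  (forall y, B y -> `|g y| <= M) ->
  mu.-integrable B (EFin \o (fun y => w y * g y)).
Proof.
move=> iw mg gM.
apply: (@integrableMl _ _ _ mu B mB (EFin \o w) g iw mg).
exists M; split; first exact: num_real.
by move=> x Mx y /= By; apply: (le_trans (gM _ By)); exact: ltW.
Qed.

Lemma measurable_comp_dilation phi u (e : R) :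
  continuous phi -> measurable_fun B u ->
  measurable_fun B (fun y => phi (e * u y)).
Proof.
move=> cphi mu_; apply: measurableT_comp; first exact: continuous_measurable_fun.
exact: measurable_funM.
Qed.

(** Dominated differentiation: the derivative of the integrand in [e] is bounded by [|w|] times the
    bounds on [u] and [psi], uniformly in [e]. Only integrability of [w] is needed, so weights built
    from a second weak derivative, which may be unbounded, are covered. The conclusion has the same
    shape with weight [w * u], so the lemma can be applied twice. *)
Lemma is_derive_integral_dilation phi psi w u (M K e : R) :
  (forall t : R, is_derive t (1 : R) phi (psi t)) ->
  (forall t, `|phi t| <= M) -> (forall t, `|psi t| <= M) ->
  mu.-integrable B (EFin \o w) -> measurable_fun B u ->
  (forall y, B y -> `|u y| <= K) ->
  is_derive e (1 : R) (fun e : R => \int[mu]_(y in B) (w y * phi (e * u y)))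
    (\int[mu]_(y in B) (w y * u y * psi (e * u y))).
Proof.
move=> dphi phiM psiM iw mu_ uK.
have cphi : continuous phi.
  by move=> t; apply: differentiable_continuous; apply/derivable1_diffP; case: (dphi t).
have df (x : R) y : is_derive x (1 : R) (fun x : R => w y * phi (x * u y))
    (w y * u y * psi (x * u y)).
  have du : is_derive x (1 : R) (fun x : R => x * u y) (u y).
    rewrite (_ : (fun x => _) = u y *: (id : R -> R)); last first.
      by apply/funext => z; rewrite mulrC.
    by apply: is_derive_eq; rewrite /GRing.scale /= mulr1.
  rewrite -mulrA (mulrC (u y)).
  have dc := @is_derive1_comp R phi (fun x => x * u y) x _ _ (dphi (x * u y)) du.
  exact: (is_deriveZ (w y) dc).
(* Any open window around [e] would do, since the dominating function [G] below does not depend on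
   the parameter. *)
have Ie : `](e - 1), (e + 1)[%classic e.
  by rewrite /= in_itv /= ltrBlDr ltrDl ltr01.
(* The absolute values on [K] and [M] make [G] nonnegative even where no [y] in [B] forces the sign
   of [K]. *)
pose G y := `|w y| * (`|K| * `|M|).
have G0 y : 0 <= G y by rewrite /G !mulr_ge0.
have intf x : `](e - 1), (e + 1)[%classic x ->
    mu.-integrable B (EFin \o (fun y => w y * phi (x * u y))).
  move=> _; apply: (integrable_mul_bounded (M := M)) => //.
  exact: measurable_comp_dilation.
have derf x y : `](e - 1), (e + 1)[%classic x -> B y ->
    derivable ((fun x y => w y * phi (x * u y))^~ y) x 1.
  by move=> _ _; case: (df x y).
have intG : mu.-integrable B (EFin \o G).
  apply: (integrable_mul_bounded (w := Num.norm \o w) (g := cst (`|K| * `|M|)) (M := `|K| * `|M|)).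
  - exact: integrable_norm.
  - exact: measurable_cst.
  - by move=> y _; rewrite /= ger0_norm ?mulr_ge0.
have partialE x y : partial1of2 (fun x y => w y * phi (x * u y)) x y =
    w y * u y * psi (x * u y).
  by rewrite partial1of2E; exact: derive_val.
have Gub x y : `](e - 1), (e + 1)[%classic x -> B y ->
    `|partial1of2 (fun x y => w y * phi (x * u y)) x y| <= G y.
  move=> _ By; rewrite partialE !normrM -mulrA /G ler_wpM2l// ler_pM//.
    exact: le_trans (uK _ By) (ler_norm _).
  exact: le_trans (psiM _) (ler_norm _).
apply: DeriveDef.
  exact: (derivable_under_integral mB Ie intf derf G0 intG Gub).
rewrite -derive1E (differentiation_under_integral mB Ie intf derf G0 intG Gub).
by apply: eq_Rintegral => y _; rewrite partialE.
Qed.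

End DilationIntegral.

(** * One-variable calculus: second derivatives at 0 and powers of the sine *)

Section Calculus.
Context {R : realType}.

(** This is the form of the energy along a ray. To second order at 0 the quartic term disappears,
    and the product [e ^+ 2 * A e] contributes only [2 * A 0], because derivatives of [A] always
    come with a factor [e]. *)
Lemma second_derivative_at0 (S S1 A A1 : R -> R) (C P Q s2 a2 : R) :
  (forall e : R, is_derive e (1 : R) S (S1 e)) -> is_derive (0 : R) (1 : R) S1 s2 ->
  (forall e : R, is_derive e (1 : R) A (A1 e)) -> is_derive (0 : R) (1 : R) A1 a2 ->
  let G e := C + S e + e ^+ 2 * P + e ^+ 4 * Q + e ^+ 2 * A e in
  is_derive (0 : R) (1 : R) G (S1 0) /\ G^`(2)%classic 0 = s2 + 2 * P + 2 * A 0.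
Proof.
move=> dS dS1 dA dA1 G.
have GE : G = cst C + S + P *: (id ^+ 2 : R -> R) + Q *: (id ^+ 4 : R -> R)
              + (id ^+ 2 : R -> R) * A.
  by apply/funext => e; rewrite /G /= (mulrC (e ^+ 2) P) (mulrC (e ^+ 4)).
pose G1 (e : R) := S1 e + 2 * P * e + 4 * Q * e ^+ 3 + 2 * (e * A e) + e ^+ 2 * A1 e.
have G1E : G1 = S1 + (2 * P) *: (id : R -> R) + (4 * Q) *: (id ^+ 3 : R -> R)
    + 2 *: ((id : R -> R) * A) + (id ^+ 2 : R -> R) * A1.
  exact/funext.
have dX n (e : R) : is_derive e (1 : R) (id ^+ n : R -> R) (n%:R * e ^+ n.-1).
  by apply: is_derive_eq (is_deriveX n (is_derive_id e 1)) _; rewrite /GRing.scale /= mulr1.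
have dG e : is_derive e (1 : R) G (G1 e).
  rewrite GE; apply: is_derive_eq (is_deriveD (is_deriveD (is_deriveD (is_deriveD
    (is_derive_cst C e 1) (dS e)) (is_deriveZ P (dX 2%N e))) (is_deriveZ Q (dX 4%N e)))
    (is_deriveM (dX 2%N e) (dA e))) _.
  by rewrite /G1 !fctE /GRing.scale /=; ring.
split.
  apply: is_derive_eq (dG 0) _.
  by rewrite /G1; ring.
(* The first derivative is identified as a function, not only at 0, so that it can be differentiated
   again. *)
have GE1 : G^`()%classic = G1.
  by apply/funext => e; rewrite derive1E; apply: derive_val; exact: dG.
rewrite derive1nS derive1n1 GE1 derive1E.
have dG1 : is_derive (0 : R) (1 : R) G1 (s2 + 2 * P + 2 * A 0).
  rewrite G1E; apply: is_derive_eq (is_deriveD (is_deriveD (is_deriveD (is_deriveD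
    dS1 (is_deriveZ (2 * P) (is_derive_id (0 : R) (1 : R)))) (is_deriveZ (4 * Q) (dX 3%N 0)))
    (is_deriveZ 2 (is_deriveM (is_derive_id (0 : R) (1 : R)) (dA 0))))
    (is_deriveM (dX 2%N 0) dA1)) _.
  by rewrite /= /GRing.scale /= !fctE /GRing.scale /=; ring.
exact: derive_val.
Qed.

Lemma is_derive_sin2 (t : R) :
  is_derive t (1 : R) (fun t : R => sin t ^+ 2) (2 * (sin t * cos t)).
Proof.
rewrite (_ : (fun t => _) = (sin : R -> R) ^+ 2); last exact/funext.
apply: is_derive_eq.
by rewrite /GRing.scale /= -mulr_natl expr1; ring.
Qed.

Lemma is_derive_sin_cos (t : R) :
  is_derive t (1 : R) (fun t : R => 2 * (sin t * cos t))
    (2 * (cos t ^+ 2 - sin t ^+ 2)).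
Proof.
rewrite (_ : (fun t => _) = 2 *: ((sin : R -> R) * cos)); last exact/funext.
by apply: is_derive_eq; rewrite /GRing.scale /=; ring.
Qed.

Lemma is_derive_sin4 (t : R) :
  is_derive t (1 : R) (fun t : R => sin t ^+ 4) (4 * (sin t ^+ 3 * cos t)).
Proof.
rewrite (_ : (fun t => _) = (sin : R -> R) ^+ 4); last exact/funext.
apply: is_derive_eq.
by rewrite /GRing.scale /= -mulr_natl; ring.
Qed.

Lemma is_derive_sin3_cos (t : R) :
  is_derive t (1 : R) (fun t : R => 4 * (sin t ^+ 3 * cos t))
    (4 * (3 * sin t ^+ 2 * cos t ^+ 2 - sin t ^+ 4)).
Proof.
rewrite (_ : (fun t => _) = 4 *: ((sin : R -> R) ^+ 3 * cos)); last exact/funext.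
apply: is_derive_eq
  (is_deriveZ 4 (is_deriveM (is_deriveX 3 (is_derive_sin t)) (is_derive_cos t))) _.
by rewrite !fctE /GRing.scale /=; ring.
Qed.

(** One crude constant serves for all the functions involved; 16 = 4 * (3 + 1) is what the triangle
    inequality gives for the last and largest of them. *)
Lemma trig_bounds (t : R) :
  [/\ `|sin t ^+ 2| <= 16, `|2 * (sin t * cos t)| <= 16,
      `|2 * (cos t ^+ 2 - sin t ^+ 2)| <= 16, `|sin t ^+ 4| <= 16
    & `|4 * (sin t ^+ 3 * cos t)| <= 16 /\
      `|4 * (3 * sin t ^+ 2 * cos t ^+ 2 - sin t ^+ 4)| <= 16].
Proof.
have s1 := sin_max t; have c1 := cos_max t.
have s n : `|sin t ^+ n| <= 1 by rewrite normrX exprn_ile1.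
have c n : `|cos t ^+ n| <= 1 by rewrite normrX exprn_ile1.
have m (x y : R) : `|x| <= 1 -> `|y| <= 1 -> `|x * y| <= 1.
  by move=> ? ?; rewrite normrM mulr_ile1.
have s2 := s 2%N; have s4 := s 4%N; have c2 := c 2%N.
have sc := m _ _ s1 c1; have s3c := m _ _ (s 3%N) c1; have s2c2 := m _ _ s2 c2.
rewrite -mulrA.
move: s2 s4 c2 sc s3c s2c2; rewrite !ler_norml.
(* With the products turned into atoms bounded by 1 in absolute value, every claim is linear. *)
move: (sin t ^+ 2) (sin t ^+ 4) (cos t ^+ 2) (sin t * cos t) (sin t ^+ 3 * cos t) => a b c' d e.
move: (a * c') => f.
by do 6 (move=> /andP[? ?]); split; [| | | |split]; apply/andP; split; lra.
Qed.

End Calculus.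

(** * First and second variation over an abstract finite measure space *)

Section FiniteMeasure.
Context {R : realType} {d : measure_display} {Y : measurableType d}.
Context (mu : {measure set Y -> \bar R}) (B : set Y).
Hypotheses (mB : measurable B) (muB : (mu B < +oo)%E).
Implicit Types u v : Y -> R.
Local Notation integrable f := (mu.-integrable B (EFin \o (f : Y -> R))).

Let integrableD_EFin u v : integrable u -> integrable v ->
  integrable (fun x => u x + v x).
Proof.
move=> iu iv; rewrite (_ : EFin \o _ = (EFin \o u) \+ (EFin \o v))%E//.
exact: integrableD.
Qed.

Let integrableZ_EFin (k : R) u : integrable u -> integrable (fun x => k * u x).
Proof.
move=> iu; rewrite (_ : EFin \o _ = fun x => k%:E * (EFin \o u) x)%E//.
exact: integrableZl.
Qed.

(** The squares of [u + v] and [u - v] are nonnegative, so [|u v|] is dominated by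
    [u ^+ 2 + v ^+ 2]. *)
Lemma sqr_integrable_mul u v :
  measurable_fun B u -> integrable (fun x => u x ^+ 2) ->
  measurable_fun B v -> integrable (fun x => v x ^+ 2) ->
  integrable (fun x => u x * v x).
Proof.
move=> mu_ iu mv iv.
apply: (le_integrable mB _ _ (integrableD_EFin iu iv)).
  by apply/measurable_EFinP; exact: measurable_funM.
move=> x _; rewrite /= lee_fin (ger0_norm (addr_ge0 (sqr_ge0 _) (sqr_ge0 _))).
rewrite ler_norml.
have := sqr_ge0 (u x + v x); have := sqr_ge0 (u x - v x).
have := sqr_ge0 (u x); have := sqr_ge0 (v x).
rewrite sqrrB sqrrD; move: (u x ^+ 2) (v x ^+ 2) (u x * v x) => p q r ? ? ? ?.
by apply/andP; split; lra.
Qed.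

(** * The energy along a ray, with [a], [b] for the first perturbation and its derivative, [r], [s]
    for the second perturbation and its second derivative, and [c] for [cos theta0] *)

Section Profile.
Context (k1 sigma dd f l1 l2 q c : R) (a b r s : Y -> R) (K : R).
Hypotheses (ma : measurable_fun B a)
  (mr : measurable_fun B r) (ms : measurable_fun B s).
Hypotheses (ib : integrable (fun x => b x ^+ 2))
  (is_ : integrable (fun x => s x ^+ 2)).
Hypotheses (aK : forall x, B x -> `|a x| <= K) (rK : forall x, B x -> `|r x| <= K).

Let bounded_integrable u M : measurable_fun B u -> (forall x, B x -> `|u x| <= M) ->
  integrable u.
Proof.
move=> mu_ uM; apply: measurable_bounded_integrable => //.
exists M; split; first exact: num_real.
by move=> x Mx y /= By; apply: (le_trans (uM _ By)); exact: ltW.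
Qed.

Let sqr_bounded u : (forall x, B x -> `|u x| <= K) ->
  forall x, B x -> `|u x ^+ 2| <= K ^+ 2.
Proof.
move=> uK x Bx; rewrite normrX lerXn2r ?nnegrE//; last exact: uK.
exact: le_trans (uK _ Bx).
Qed.

Let ir2 : integrable (fun x => r x ^+ 2).
Proof.
by apply: bounded_integrable (sqr_bounded rK); exact: measurable_funX.
Qed.

Let ia2 : integrable (fun x => a x ^+ 2).
Proof.
by apply: bounded_integrable (sqr_bounded aK); exact: measurable_funX.
Qed.

Let ir4 : integrable (fun x => r x ^+ 4).
Proof.
rewrite (_ : (fun x => _) = fun x => r x ^+ 2 * r x ^+ 2).
  by apply: (integrable_mul_bounded mB ir2 _ (sqr_bounded rK)); exact: measurable_funX.
by apply/funext => x; rewrite -exprD.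
Qed.

Let irs : integrable (fun x => r x * s x).
Proof. exact: sqr_integrable_mul. Qed.

(** The coefficient of [e ^+ 2] free of trigonometric factors. Its last term is the sine-free part
    of the [l2] square; joined to [dd / 2], it produces the stability threshold. *)
Let quadratic x := k1 * b x ^+ 2 + (dd / 2 * r x ^+ 2 + (l1 * (s x + q ^+ 2 * r x) ^+ 2
    + l2 * (q ^+ 4 * c ^+ 4) * r x ^+ 2)).

Let ip : integrable quadratic.
Proof.
do 2 (apply: integrableD_EFin; first exact: integrableZ_EFin).
apply: integrableD_EFin; last exact: integrableZ_EFin.
apply: integrableZ_EFin.
rewrite (_ : (fun x => _) = fun x => s x ^+ 2 + (2 * q ^+ 2 * (r x * s x)
  + q ^+ 4 * r x ^+ 2)); last by apply/funext => x; ring.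
apply: integrableD_EFin => //.
by apply: integrableD_EFin; exact: integrableZ_EFin.
Qed.

Let energy_profile (e : R) := \int[mu]_(x in B)
    (k1 * (e * b x) ^+ 2 - k1 * sigma ^+ 2 * cos (e * a x) ^+ 2
     + dd / 2 * (e * r x) ^+ 2 + f / 4 * (e * r x) ^+ 4
     + l1 * (e * s x + q ^+ 2 * (e * r x)) ^+ 2
     + l2 * (sin (e * a x) ^+ 2 * (e * s x) + q ^+ 2 * (e * r x) * c ^+ 2) ^+ 2).

(** [w1] and [w2] are the weights of the fourth and second powers of the sine in the expanded [l2]
    square. As [s] is only square integrable, they are integrable but possibly unbounded. *)
Let w1 x := l2 * s x ^+ 2.
Let w2 x := 2 * l2 * q ^+ 2 * c ^+ 2 * (r x * s x).
Let dil phi w (e : R) := \int[mu]_(x in B) (w x * phi (e * a x)) : R.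

Let iw1 : integrable w1. Proof. exact: integrableZ_EFin. Qed.
Let iw2 : integrable w2. Proof. exact: integrableZ_EFin. Qed.
Let iw0 (k : R) : integrable (cst k).
Proof. by apply: (@bounded_integrable _ `|k|) => //; exact: measurable_cst. Qed.

Let continuous_sinX n : continuous (fun t : R => sin t ^+ n).
Proof.
by move=> t; apply: (@continuous_comp _ _ _ sin (fun x => x ^+ n));
  [exact: continuous_sin|exact: exprn_continuous].
Qed.

Let idil n w e : integrable w -> integrable (fun x => w x * sin (e * a x) ^+ n).
Proof.
move=> iw; apply: (integrable_mul_bounded (M := 1) mB iw).
  by apply: (@measurable_comp_dilation _ _ _ _ (fun t : R => sin t ^+ n)).
by move=> x _; rewrite normrX exprn_ile1// sin_max.
Qed.

(** Replacing the squared cosine by 1 minus the squared sine and expanding the [l2] square isolates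
    all trigonometric dependence on [e] in integrals of type [dil], which matches the form required
    by [second_derivative_at0]. *)
Lemma energy_profileE e : energy_profile e =
  \int[mu]_(x in B) (- (k1 * sigma ^+ 2)) +
  dil (fun t => sin t ^+ 2) (cst (k1 * sigma ^+ 2)) e +
  e ^+ 2 * \int[mu]_(x in B) quadratic x +
  e ^+ 4 * \int[mu]_(x in B) (f / 4 * r x ^+ 4) +
  e ^+ 2 * (dil (fun t => sin t ^+ 4) w1 e + dil (fun t => sin t ^+ 2) w2 e).
Proof.
have i4 : integrable (fun x => f / 4 * r x ^+ 4) by exact: integrableZ_EFin.
have iS := idil 2 e (iw0 (k1 * sigma ^+ 2)).
have i41 := idil 4 e iw1; have i22 := idil 2 e iw2.
have iA := integrableD_EFin i41 i22.
have iC := iw0 (- (k1 * sigma ^+ 2)).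
rewrite -!RintegralD// -!RintegralZl// -!RintegralD//;
  try by [exact: integrableZ_EFin | do ?apply: integrableD_EFin => //; exact: integrableZ_EFin].
apply: eq_Rintegral => x _.
rewrite /quadratic /w1 /w2 /= (cos2sin2 (e * a x)); ring.
Qed.

Lemma energy_profile_derivatives :
  is_derive (0 : R) (1 : R) energy_profile 0 /\
  energy_profile^`(2)%classic 0 =
  \int[mu]_(x in B) (2 * k1 * sigma ^+ 2 * a x ^+ 2 + 2 * quadratic x).
Proof.
rewrite (funext energy_profileE).
pose k := k1 * sigma ^+ 2.
have b0 t := let: And5 h _ _ _ _ := @trig_bounds R t in h.
have b1 t := let: And5 _ h _ _ _ := @trig_bounds R t in h.
have b2 t := let: And5 _ _ h _ _ := @trig_bounds R t in h.
have b3 t := let: And5 _ _ _ h _ := @trig_bounds R t in h.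
have b4 t := let: And5 _ _ _ _ (conj h _) := @trig_bounds R t in h.
have b5 t := let: And5 _ _ _ _ (conj _ h) := @trig_bounds R t in h.
have iwa w : integrable w -> integrable (fun x => w x * a x).
  by move=> iw; exact: (integrable_mul_bounded mB iw ma aK).
have dS w e : integrable w ->
    is_derive e (1 : R) (dil (fun t => sin t ^+ 2) w)
      (dil (fun t => 2 * (sin t * cos t)) (fun x => w x * a x) e).
  by move=> iw; exact: (is_derive_integral_dilation mB e (@is_derive_sin2 R) b0 b1 iw ma aK).
have dS1 w e : integrable w ->
    is_derive e (1 : R) (dil (fun t => 2 * (sin t * cos t)) w)
      (dil (fun t => 2 * (cos t ^+ 2 - sin t ^+ 2)) (fun x => w x * a x) e).
  by move=> iw; exact: (is_derive_integral_dilation mB e (@is_derive_sin_cos R) b1 b2 iw ma aK).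
have dA w e : integrable w ->
    is_derive e (1 : R) (dil (fun t => sin t ^+ 4) w)
      (dil (fun t => 4 * (sin t ^+ 3 * cos t)) (fun x => w x * a x) e).
  by move=> iw; exact: (is_derive_integral_dilation mB e (@is_derive_sin4 R) b3 b4 iw ma aK).
have dA1 w e : integrable w ->
    is_derive e (1 : R) (dil (fun t => 4 * (sin t ^+ 3 * cos t)) w)
      (dil (fun t => 4 * (3 * sin t ^+ 2 * cos t ^+ 2 - sin t ^+ 4)) (fun x => w x * a x) e).
  by move=> iw; exact: (is_derive_integral_dilation mB e (@is_derive_sin3_cos R) b4 b5 iw ma aK).
have dil0 phi w : phi 0 = 0 -> dil phi w 0 = 0.
  move=> phi0; rewrite /dil (_ : (fun x => _) = cst 0); first by rewrite Rintegral_cst// mul0r.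
  by apply/funext => x; rewrite mul0r phi0 mulr0.
(* Here [S] is the squared-sine integral with constant weight [k], and [A] is the sum of the two
   integrals coming from the [l2] square. *)
have [] := @second_derivative_at0 R _ _ _ _
  (\int[mu]_(x in B) (- k)) (\int[mu]_(x in B) quadratic x)
  (\int[mu]_(x in B) (f / 4 * r x ^+ 4)) _ _
  (fun e => dS _ e (iw0 k)) (dS1 _ 0 (iwa _ (iw0 k)))
  (fun e => is_deriveD (dA _ e iw1) (dS _ e iw2))
  (is_deriveD (dA1 _ 0 (iwa _ iw1)) (dS1 _ 0 (iwa _ iw2))).
rewrite [X in is_derive _ _ _ X]dil0 ?sin0 ?mul0r ?mulr0// => D1 ->; split; first exact: D1.
(* Both integrals in [A] vanish at 0 since the sine does, so the mixed [l2] terms leave no trace at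
   second order. *)
rewrite !fctE (dil0 (fun t => sin t ^+ 4)) ?sin0 ?expr0n//.
rewrite (dil0 (fun t => sin t ^+ 2)) ?sin0 ?expr0n// addr0 mulr0 addr0.
have i2a := integrableZ_EFin (2 * k1 * sigma ^+ 2) ia2.
have i2p := integrableZ_EFin 2 ip.
rewrite [RHS]RintegralD//; congr (_ + _); last by rewrite RintegralZl.
(* The second derivative of the squared sine at 0 is 2, which turns the weight [k] into
   [2 * k1 * sigma ^+ 2 * a x ^+ 2]. *)
apply: eq_Rintegral => x _; rewrite /k mul0r sin0 cos0 /=; ring.
Qed.

(** The bound is pointwise: drop the nonnegative [k1] and [l1] squares, then compare the
    coefficients of [a x ^+ 2] and [r x ^+ 2] with [m]. *)
Lemma second_variation_ge (m : R) : 0 <= k1 -> 0 <= l1 ->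
  m <= 2 * k1 * sigma ^+ 2 -> m <= dd + 2 * l2 * q ^+ 4 * c ^+ 4 ->
  m * \int[mu]_(x in B) (a x ^+ 2 + r x ^+ 2) <=
  \int[mu]_(x in B) (2 * k1 * sigma ^+ 2 * a x ^+ 2 + 2 * quadratic x).
Proof.
move=> k10 l10 ma_ mr_; have iar := integrableD_EFin ia2 ir2.
have isv := integrableD_EFin (integrableZ_EFin (2 * k1 * sigma ^+ 2) ia2)
  (integrableZ_EFin 2 ip).
have imar := integrableZ_EFin m iar.
rewrite -RintegralZl//; apply: le_Rintegral => // x _; rewrite /quadratic.
have := ler_wpM2r (sqr_ge0 (a x)) ma_; have := ler_wpM2r (sqr_ge0 (r x)) mr_.
have := mulr_ge0 k10 (sqr_ge0 (b x)).
have := mulr_ge0 l10 (sqr_ge0 (s x + q ^+ 2 * r x)).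
move: (l1 * _) (k1 * b x ^+ 2) => p1 p2; lra.
Qed.

End Profile.
End FiniteMeasure.

(** A Chebyshev-type bound: shrink the domain by nonnegativity, then compare with a constant on
    [A]. *)
Lemma Rintegral_subset_ge {R : realType} {d : measure_display} {Y : measurableType d}
    (mu : {measure set Y -> \bar R}) (A B : set Y) (u : Y -> R) (c : R) :
  measurable A -> measurable B -> (mu A < +oo)%E ->
  mu.-integrable B (EFin \o u) -> (forall x, B x -> 0 <= u x) -> A `<=` B ->
  (forall x, A x -> c <= u x) ->
  c * fine (mu A) <= \int[mu]_(x in B) u x.
Proof.
move=> mA mB muA iu u0 AB cu; have iA := integrableS mB mA AB iu.
rewrite -Rintegral_cst//; apply: (@le_trans _ _ (\int[mu]_(x in A) u x)).
  apply: le_Rintegral => //.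
  apply: measurable_bounded_integrable => //; exact: bounded_cst.
apply: fine_le; [exact: integrable_fin_num..|].
by apply: ge0_subset_integral => //; exact: measurable_int iu.
Qed.

(** * Continuous functions on the closed interval, integrated over its interior *)

Section Interval.
Context {R : realType} (h : R) (h0 : 0 < h).
Local Notation mu := (@lebesgue_measure R).
Local Notation D := (`]0, h[%classic : set R).
Implicit Types u v : R -> R.

Lemma measurable_itv0 : measurable (D : set (measurableTypeR R)).
Proof. exact: measurable_itv. Qed.

Lemma measure_itv0 : (mu D < +oo)%E.
Proof.
rewrite [X in (X < _)%E](lebesgue_measure_itv `]0, h[) /=.
by case: ifP => _; rewrite ltry.
Qed.

Lemma within_continuous_bounded u : {within `[0, h], continuous u} ->
  exists K, forall x, `]0, h[%classic x -> `|u x| <= K.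
Proof.
move=> cu.
have cnu : {within `[0, h], continuous (fun x => `|u x|)}.
  by move=> x; apply: (continuous_comp (cu x)); exact: norm_continuous.
have [c _ cM] := EVT_max (ltW h0) cnu.
by exists `|u c| => x Dx; apply: cM; exact: subset_itv_oo_cc Dx.
Qed.

Lemma within_continuous_integrable u : {within `[0, h], continuous u} ->
  mu.-integrable D (EFin \o u).
Proof.
move=> cu; apply: (@integrableS _ _ _ mu `[0, h]%classic).
- exact: measurable_itv.
- exact: measurable_itv.
- exact: subset_itv_oo_cc.
- by apply: continuous_compact_integrable; [exact: segment_compact|].
Qed.

Lemma within_continuous_L2 u : {within `[0, h], continuous u} -> L2 h u.
Proof.
move=> cu; split.
  apply: (@measurable_funS _ _ _ _ `[0, h]%classic).
  - exact: measurable_itv.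
  - exact: subset_itv_oo_cc.
  - by apply: subspace_continuous_measurable_fun; [exact: measurable_itv|].
apply: (@within_continuous_integrable (fun x => u x ^+ 2)) => x.
apply: (@continuous_comp (subspace `[0, h]) R R u (fun y => y ^+ 2)).
  exact: cu.
exact: exprn_continuous.
Qed.

(** By continuity [u] exceeds half of [u x0] near [x0], hence on a subinterval of positive
    length. *)
Lemma Rintegral_itv_gt0 u (x0 : R) : {within `[0, h], continuous u} ->
  (forall x, 0 <= u x) -> 0 <= x0 <= h -> 0 < u x0 ->
  0 < \int[mu]_(x in D) u x.
Proof.
move=> cu u0 /andP[x00 x0h] ux0.
have iu := within_continuous_integrable cu.
have x0D : `[0, h]%classic x0 by rewrite /= in_itv /= x00.
have : \forall x \near within `[0, h] (nbhs x0), u x0 / 2 < u x.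
  have /subspace_continuousP/(_ _ x0D) cux0 := cu.
  by apply: (cvgr_gt _ cux0); rewrite ltr_pdivrMr// ltr_pMr// ltr1n.
move=> [e /= e0 He].
(* Since [x0] may be an endpoint, the neighbourhood is cut down to the interval; it stays
   nondegenerate. *)
pose a := Num.max 0 (x0 - e); pose b := Num.min h (x0 + e).
have ab : a < b.
  rewrite /a /b lt_min !gt_max h0 /=.
  by apply/andP; split; [lra|apply/andP; split; lra].
have sab : `]a, b[%classic `<=` D.
  move=> x /=; rewrite !in_itv /= /a /b gt_max lt_min.
  by move=> /andP[/andP[-> _] /andP[-> _]].
have uab x : `]a, b[%classic x -> u x0 / 2 <= u x.
  move=> xab; apply/ltW/He.
    move: xab; rewrite /= in_itv /= /a /b gt_max lt_min => /andP[/andP[? ?] /andP[? ?]].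
    by rewrite distrC ltr_norml; apply/andP; split; lra.
  exact: subset_itv_oo_cc (sab _ xab).
have mab : measurable (`]a, b[%classic : set (measurableTypeR R)).
  exact: measurable_itv.
have muab : mu `]a, b[%classic = (b - a)%:E.
  by rewrite [LHS](lebesgue_measure_itv `]a, b[) /= lte_fin ab.
apply: (lt_le_trans _ (Rintegral_subset_ge mab measurable_itv0 _ iu _ sab uab)) => //.
  by rewrite [X in fine X]muab /= mulr_gt0 ?subr_gt0// divr_gt0.
by rewrite [X in (X < _)%E]muab ltry.
Qed.
End Interval.

(** * Sobolev membership of the zero configuration and of the sine mode *)

Section Sobolev.
Context {R : realType} (h : R) (h0 : 0 < h).
Local Notation mu := (@lebesgue_measure R).
Implicit Types u v phi : R -> R.

Lemma Rintegral_itv_oo_cc u : {within `[0, h], continuous u} ->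
  \int[mu]_(x in `]0, h[) u x = \int[mu]_(x in `[0, h]) u x.
Proof.
move=> cu.
have iu : mu.-integrable `[0, h] (EFin \o u).
  by apply: continuous_compact_integrable; [exact: segment_compact|].
rewrite Rintegral_itv_obnd_cbnd; last exact: within_continuous_integrable.
rewrite Rintegral_itv_bndo_bndc//.
apply: integrableS iu; [exact: measurable_itv|exact: measurable_itv|].
by apply: subset_itvl; rewrite bnd_simp.
Qed.

Lemma derivable_oo_LRcontinuousT u : (forall x : R, derivable u x 1) ->
  derivable_oo_LRcontinuous u 0 h.
Proof.
move=> du; have cu : continuous u.
  by move=> x; apply: differentiable_continuous; apply/derivable1_diffP.
split; first by move=> x _; exact: du.
- exact/cvg_at_right_filter/cu.
- exact/cvg_at_left_filter/cu.
Qed.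

Lemma test_function_boundary phi : test_function h phi -> phi 0 = 0 /\ phi h = 0.
Proof.
move=> [_ [_ sub]].
have zero x : ~ `]0, h[%classic x -> phi x = 0.
  move=> nx; apply: contrapT => /eqP phi0; apply: nx; apply: sub.
  exact: (@subset_closure _ [set x | phi x != 0]).
by split; apply: zero; rewrite /= in_itv /= ltxx ?andbF.
Qed.

(** A classical continuous derivative is a weak one: in the integration by parts the boundary terms
    vanish, because a test function is supported inside the open interval. *)
Lemma W12_derivative u v : (forall x : R, is_derive x (1 : R) u (v x)) ->
  continuous v -> W12 h (u, v).
Proof.
move=> duv cv; have du x : derivable u x 1 by case: (duv x).
have cu : continuous u.
  by move=> x; apply: differentiable_continuous; apply/derivable1_diffP.
have cuw : {within `[0, h], continuous u} by exact: continuous_subspaceT.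
have cvw : {within `[0, h], continuous v} by exact: continuous_subspaceT.
split; [exact: cuw|exact: within_continuous_L2|exact: within_continuous_L2|].
move=> phi tphi; have [phi0 phih] := test_function_boundary tphi.
have [dphi _] := tphi.
have dphi0 x : derivable phi x 1 by exact: dphi 0%N x.
have cphi : continuous phi.
  by move=> x; apply: differentiable_continuous; apply/derivable1_diffP.
have cphi' : continuous phi^`()%classic.
  move=> x; apply: differentiable_continuous; apply/derivable1_diffP.
  exact: dphi 1%N x.
have prod_cont (w1 w2 : R -> R) : continuous w1 -> continuous w2 ->
    {within `[0, h], continuous (fun x => w1 x * w2 x)}.
  by move=> c1 c2; apply: continuous_subspaceT => x; exact: continuousM (c1 x) (c2 x).
rewrite /= !Rintegral_itv_oo_cc; [|exact: prod_cont..].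
rewrite (@Rintegration_by_parts R u phi v phi^`()%classic)//.
- by rewrite phi0 phih !mulr0 subrr sub0r.
- exact: derivable_oo_LRcontinuousT.
- by move=> x _; rewrite derive1E; apply: derive_val; exact: duv.
- exact: continuous_subspaceT.
- exact: derivable_oo_LRcontinuousT.
Qed.

Lemma W12_0 : W12 h (0 : sob1 R).
Proof.
by apply: (@W12_derivative (cst 0) (cst 0)) => x; exact: cst_continuous.
Qed.

Lemma admissible0 : admissible h (0 : sob1 R) (0 : sob2 R).
Proof.
have r0 : right_derivative (cst 0 : R -> R) 0 0.
  rewrite /right_derivative (_ : (fun x => _) = cst 0); first exact: cvg_cst.
  by apply/funext => x; rewrite /= subrr mul0r.
have l0 : left_derivative (cst 0 : R -> R) h 0.
  rewrite /left_derivative (_ : (fun x => _) = cst 0); first exact: cvg_cst.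
  by apply/funext => x; rewrite /= subrr mul0r.
split.
- exact: W12_0.
- move=> x _; rewrite (_ : fn1 _ x = 0)//; have := pi_ge0 R => ?.
  by apply/andP; split; lra.
- by split.
- by split => //; split; exact: W12_0.
- by exists 0; split.
Qed.

(** The destabilising density wave: a solution of [u'' + q ^+ 2 u = 0], packed with its first two
    derivatives. *)
Definition sine_mode (q : R) : sob2 R :=
  (fun z => sin (q * z), fun z => q * cos (q * z), fun z => - q ^+ 2 * sin (q * z)).

Lemma sine_mode_W22per (n0 : nat) :
  W22per h (sine_mode (2 * pi * n0%:R / h)).
Proof.
set q := 2 * pi * n0%:R / h.
(* The interval holds exactly [n0] periods; written as a multiple of [pi *+ 2], this yields the
   periodic boundary conditions. *)
have qh : q * h = pi *+ 2 *+ n0 by rewrite /q divfK ?gt_eqF// mulr_natr mulr_natl.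
have dq (x : R) : is_derive x (1 : R) (fun z : R => q * z) q.
  apply: is_derive_eq (is_deriveZ q (is_derive_id x (1 : R))) _.
  by rewrite /GRing.scale /= mulr1.
have dsin (x : R) : is_derive x (1 : R) (fun z : R => sin (q * z)) (q * cos (q * x)).
  rewrite mulrC.
  exact: (@is_derive1_comp R sin (fun z => q * z) x _ _ (is_derive_sin _) (dq x)).
have dcos (x : R) : is_derive x (1 : R) (fun z : R => q * cos (q * z))
    (- q ^+ 2 * sin (q * x)).
  have dc := @is_derive1_comp R cos (fun z => q * z) x _ _ (is_derive_cos _) (dq x).
  apply: is_derive_eq (is_deriveZ q dc) _.
  by rewrite /GRing.scale /=; ring.
have cq g : continuous (g : R -> R) -> continuous (fun z : R => g (q * z)).
  move=> cg x; apply: (@continuous_comp R R R (fun z => q * z) g); last exact: cg.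
  exact: mulrl_continuous.
have cqq k g : continuous (g : R -> R) -> continuous (fun z : R => k * g (q * z)).
  move=> cg x; apply: (@continuous_comp R R R (fun z => g (q * z)) (fun y => k * y)).
    exact: cq.
  exact: mulrl_continuous.
split.
- split.
    by apply: W12_derivative => //; apply: cqq; exact: continuous_cos.
  by apply: W12_derivative => //; apply: cqq; exact: continuous_sin.
- by rewrite /fn2 /= mulr0 qh -[pi *+ 2 *+ n0]add0r (periodicn (@sinD2pi R)).
- by rewrite /dz2 /= mulr0 qh -[pi *+ 2 *+ n0]add0r (periodicn (@cosD2pi R)).
Qed.
End Sobolev.

(** * Transfer to the energy on the interval *)

Section SecondVariation.
Context {R : realType} (h : R) (h0 : 0 < h) (k1 sigma d f lambda1 lambda2 q theta0 : R).
Local Notation mu := (@lebesgue_measure R).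
Local Notation F := (energy h k1 sigma d f lambda1 lambda2 q theta0).

(** Continuity up to the boundary bounds both perturbations, which serves the domination in [eta1]
    and the integrability of the quartic term in [eta2]. *)
Lemma variation_bound eta1 eta2 : W12 h eta1 -> W22 h eta2 ->
  exists K, (forall x, `]0, h[%classic x -> `|fn1 eta1 x| <= K) /\
            (forall x, `]0, h[%classic x -> `|fn2 eta2 x| <= K).
Proof.
move=> [c1 _ _ _] [[c2 _ _ _] _].
have [K1 hK1] := within_continuous_bounded h0 c1.
have [K2 hK2] := within_continuous_bounded h0 c2.
exists (Num.max K1 K2); split => x.
  by move=> /hK1 le; rewrite le_max le.
by move=> /hK2 le; rewrite le_max le orbT.
Qed.

Lemma energy_variations eta1 eta2 : W12 h eta1 -> W22 h eta2 ->
  is_derive (0 : R) (1 : R) (fun e : R => F (e *: eta1) (e *: eta2)) 0 /\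
  second_variation F eta1 eta2 =
  \int[mu]_(z in `]0, h[)
    (2 * k1 * sigma ^+ 2 * fn1 eta1 z ^+ 2 +
     2 * (k1 * dz1 eta1 z ^+ 2 + (d / 2 * fn2 eta2 z ^+ 2 +
       (lambda1 * (dzz2 eta2 z + q ^+ 2 * fn2 eta2 z) ^+ 2 +
        lambda2 * (q ^+ 4 * cos theta0 ^+ 4) * fn2 eta2 z ^+ 2)))).
Proof.
move=> W1 W2; have [K [hK1 hK2]] := variation_bound W1 W2.
have [_ [m1 _] [_ id] _] := W1; have [[_ [m2 _] _ _] [_ _ [mdd idd] _]] := W2.
(* Scaling acts on each component of the pairs and triples, so the energy along the ray is the
   abstract profile by computation. *)
exact: (@energy_profile_derivatives R _ (measurableTypeR R) mu `]0, h[%classic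
  (measurable_itv0 h) (measure_itv0 h) k1 sigma d f lambda1 lambda2 q (cos theta0)
  (fn1 eta1) (dz1 eta1) (fn2 eta2) (dzz2 eta2) K m1 m2 mdd id idd hK1 hK2).
Qed.

Lemma energy_second_variation_ge eta1 eta2 (m : R) : W12 h eta1 -> W22 h eta2 ->
  0 <= k1 -> 0 <= lambda1 -> m <= 2 * k1 * sigma ^+ 2 ->
  m <= d + 2 * lambda2 * q ^+ 4 * cos theta0 ^+ 4 ->
  m * \int[mu]_(z in `]0, h[) (fn1 eta1 z ^+ 2 + fn2 eta2 z ^+ 2) <=
  second_variation F eta1 eta2.
Proof.
move=> W1 W2 k10 l10 m1le m2le; rewrite (energy_variations W1 W2).2.
have [K [hK1 hK2]] := variation_bound W1 W2.
have [_ [m1 _] [_ id] _] := W1; have [[_ [m2 _] _ _] [_ _ [mdd idd] _]] := W2.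
exact: (@second_variation_ge R _ (measurableTypeR R) mu `]0, h[%classic
  (measurable_itv0 h) (measure_itv0 h) k1 sigma d lambda1 lambda2 q (cos theta0)
  (fn1 eta1) (dz1 eta1) (fn2 eta2) (dzz2 eta2) K m1 m2 mdd id idd hK1 hK2).
Qed.

Lemma critical_point0 : critical_point h F 0 0.
Proof.
split; first exact: admissible0.
move=> eta1 eta2 W1 [W2 _ _].
under eq_fun do rewrite !add0r.
exact: (energy_variations W1 W2).1.
Qed.

(** The representatives are continuous, so one point of the closed interval where they do not both
    vanish suffices. *)
Lemma denominator_gt0 eta1 eta2 : W12 h eta1 -> W22 h eta2 ->
  ~ (forall x, 0 <= x <= h -> fn1 eta1 x = 0 /\ fn2 eta2 x = 0) ->
  0 < \int[mu]_(z in `]0, h[) (fn1 eta1 z ^+ 2 + fn2 eta2 z ^+ 2).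
Proof.
move=> [c1 _ _ _] [[c2 _ _ _] _] /existsNP[x0 /not_implyP[x0h nz]].
apply: (Rintegral_itv_gt0 h0 (x0 := x0)) => //.
- have cX (u : R -> R) : {within `[0, h], continuous u} ->
      {within `[0, h], continuous (fun x => u x ^+ 2)}.
    move=> cu x; apply: (@continuous_comp (subspace `[0, h]) R R u (fun y => y ^+ 2)).
      exact: cu.
    exact: exprn_continuous.
  exact: (within_continuousD (cX _ c1) (cX _ c2)).
- by move=> x; rewrite addr_ge0 ?sqr_ge0.
rewrite lt_neqAle addr_ge0 ?sqr_ge0// andbT eq_sym paddr_eq0 ?sqr_ge0// !sqrf_eq0.
by apply/negP => /andP[/eqP ? /eqP ?]; apply: nz.
Qed.

End SecondVariation.

(** * The sign of [mu_T] on either side of the threshold *)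

Theorem proposition8 (R : realType)
    (h p alpha2 T T2star k1 lambda1 lambda2 f theta0 : R) (n0 : nat)
    (hh : 0 < h) (hp : 0 < p) (halpha2 : 0 < alpha2)
    (hk1 : 0 < k1) (hlambda1 : 0 < lambda1) (hlambda2 : 0 < lambda2)
    (hf : 0 < f) (htheta0 : 0 < theta0 < pi / 2) (hn0 : (0 < n0)%N) :
  let sigma := 2 * pi / p in
  let d := alpha2 * (T - T2star) in
  let q := 2 * pi * n0%:R / h in
  let F := energy h k1 sigma d f lambda1 lambda2 q theta0 in
  (0 < d + 2 * lambda2 * q ^+ 4 * cos theta0 ^+ 4 ->
     critical_point h F 0 0 /\ stable_at_zero h F) /\
  (d + 2 * lambda2 * q ^+ 4 * cos theta0 ^+ 4 < 0 ->
     critical_point h F 0 0 /\ unstable_at_zero h F).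
Proof.
move=> sigma d q F.
have sigma0 : 0 < sigma by rewrite /sigma divr_gt0// mulr_gt0// pi_gt0.
have crit : critical_point h F 0 0 by exact: critical_point0.
split => [dpos|dneg]; split => //.
(* Stability: [m] bounds every Rayleigh quotient from below. A positive lower bound is required,
   since positivity of each quotient would not make the infimum positive. *)
- pose m := Num.min (2 * k1 * sigma ^+ 2) (d + 2 * lambda2 * q ^+ 4 * cos theta0 ^+ 4).
  have m0 : 0 < m by rewrite /m lt_min dpos andbT pmulr_lgt0 ?exprn_gt0// mulr_gt0.
  apply: (@lt_le_trans _ _ m%:E); first by rewrite lte_fin.
  apply: le_ereal_inf_tmp => _ [eta1 [eta2 [W1 [W2 _ _] nz ->]]].
  rewrite lee_fin ler_pdivlMr; last exact: denominator_gt0.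
  apply: energy_second_variation_ge => //; [exact: ltW|exact: ltW| |].
    by rewrite /m ge_min lexx.
  by rewrite /m ge_min lexx orbT.
have W1 := W12_0 hh.
have W2 : W22per h (sine_mode q) by exact: sine_mode_W22per.
have [W22q _ _] := W2.
have nz : ~ (forall x, 0 <= x <= h ->
    fn1 (0 : sob1 R) x = 0 /\ fn2 (sine_mode q) x = 0).
  (* A quarter of a period: there [q * z] equals [pi / 2] and the sine is 1. *)
  move=> /(_ (h / (4 * n0%:R))) [].
    have n1 : 1 <= n0%:R :> R by rewrite ler1n.
    rewrite divr_ge0 ?mulr_ge0 ?(ltW hh)//= ler_pdivrMr ?mulr_gt0 ?ltr0n//.
    by rewrite ler_peMr ?(ltW hh)//; lra.
  move=> _; rewrite /fn2 /= (_ : q * _ = pi / 2); last first.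
    by rewrite /q; field; rewrite (gt_eqF hh) andbT pnatr_eq0 -lt0n.
  by rewrite sin_pihalf => /eqP; rewrite oner_eq0.
have den := denominator_gt0 hh W1 W22q nz.
(* The threshold quantity is itself the Rayleigh quotient of the pair formed by 0 and the sine mode,
   hence an upper bound for the infimum. *)
apply: (@le_lt_trans _ _ (d + 2 * lambda2 * q ^+ 4 * cos theta0 ^+ 4)%:E); last first.
  by rewrite lte_fin.
apply: ereal_inf_lbound; exists 0, (sine_mode q); split => //.
congr EFin; apply: (canRL (mulfK (lt0r_neq0 den))).
rewrite (energy_variations hh _ _ _ _ _ _ _ _ W1 W22q).2.
have iden : (@lebesgue_measure R).-integrable `]0, h[
    (EFin \o (fun z => fn1 (0 : sob1 R) z ^+ 2 + fn2 (sine_mode q) z ^+ 2)).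
  have [[c2 _ _ _] _] := W22q.
  rewrite (_ : (fun z => _) = fun z => fn2 (sine_mode q) z ^+ 2); last first.
    by apply/funext => z; rewrite /fn1 expr0n add0r.
  exact: (within_continuous_L2 c2).2.
rewrite -(RintegralZl _ (measurable_itv0 h) iden); apply: eq_Rintegral => z _.
(* The [lambda1] square cancels because the second derivative of the mode is [- q ^+ 2] times the
   mode. *)
by rewrite (_ : fn1 _ z = 0)// (_ : dz1 _ z = 0)// /dzz2 /fn2 /=; field.
Qed.
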